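(* Let $k$ be a field and let $\mathfrak{h}$ be a Leibniz algebra over $k$ of dimension $n$. Then there exists a unique bialgebra structure on the algebra $\mathcal{A}(\mathfrak{h})$ such that the Leibniz algebra homomorphism $\eta_{\mathfrak{h}}:\mathfrak{h}\to\mathfrak{h}\otimes\mathcal{A}(\mathfrak{h})$ becomes a right $\mathcal{A}(\mathfrak{h})$-comodule structure on $\mathfrak{h}$. More precisely, the comultiplication and the counit on $\mathcal{A}(\mathfrak{h})$ are given, for all $i,j=1,\dots,n$, by $$\Delta(x_{ij})=\sum_{s=1}^n x_{is}\otimes x_{sj}\qquad\text{and}\qquad\varepsilon(x_{ij})=\delta_{i,j}.$$ Furthermore, the canonical projection $\pi: M(n)\to\mathcal{A}(\mathfrak{h})$ becomes a bialgebra homomorphism.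
   Context: All vector spaces, algebras and tensor products are over an arbitrary field $k$; algebras are unital and algebra homomorphisms preserve units. A Leibniz algebra is a vector space $\mathfrak{h}$ with a bilinear map $[-,-]$ satisfying $[x,[y,z]] = [[x,y],z]-[[x,z],y]$ for all $x,y,z$; homomorphisms are bracket-preserving linear maps. For a Leibniz algebra $\mathfrak{h}$ and a commutative algebra $A$, $\mathfrak{h}\otimes A$ is the Leibniz algebra with bracket $[x\otimes a,y\otimes b]:=[x,y]\otimes ab$. Universal algebra $\mathcal{A}(\mathfrak{h})$: fix a basis $\{e_1,\dots,e_n\}$ of the $n$-dimensional Leibniz algebra $\mathfrak{h}$, with structure constants $[e_i,e_j]=\sum_{s=1}^n\tau_{i,j}^s e_s$. Then $\mathcal{A}(\mathfrak{h}):=k[X_{ij}\mid i,j=1,\dots,n]/J$, where $J$ is the ideal generated by the polynomials $$\sum_{u=1}^n\tau_{i,j}^u X_{au}-\sum_{s,t=1}^n\tau_{s,t}^a X_{si}X_{tj},\qquad a,i,j=1,\dots,n.$$ Write $x_{ij}$ for the class of $X_{ij}$. The map $\eta_{\mathfrak{h}}:\mathfrak{h}\to\mathfrak{h}\otimes\mathcal{A}(\mathfrak{h})$ is the linear map (a Leibniz algebra homomorphism) given by $\eta_{\mathfrak{h}}(e_i):=\sum_{s=1}^n e_s\otimes x_{si}$. $M(n)=k[X_{ij}\mid i,j=1,\dots,n]$ is the polynomial bialgebra with $\Delta(X_{ij})=\sum_{s=1}^n X_{is}\otimes X_{sj}$ and $\varepsilon(X_{ij})=\delta_{i,j}$, and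 $\pi$ is the quotient map $X_{ij}\mapsto x_{ij}$. *)

(* Defs.v *)
From HB Require Import structures.
From mathcomp Require Import all_boot all_order all_algebra.
From mathcomp Require Import boolp classical_sets.
From mathcomp Require Import freeg mpoly.

Set Implicit Arguments.
Unset Strict Implicit.
Unset Printing Implicit Defensive.

Import GRing.Theory.
Local Open Scope ring_scope.
Local Open Scope quotient_scope.

Reserved Notation "x ⊗ y" (at level 40, left associativity).

Section QuotientModule.
Variables (k : fieldType) (V : lmodType k) (I : zmodClosed V).
Hypothesis I_scale : forall c, {in I, forall v, c *: v \in I}.
Local Notation Q := (@Quotient.quot V I).

Definition quot_scale (c : k) (x : Q) : Q := \pi_Q (c *: repr x).

Lemma quot_piD u v : \pi_Q (u + v) = \pi_Q u + \pi_Q v :> Q.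
Proof. exact: Quotient.pi_add. Qed.

Lemma pi_quot_scale c v : quot_scale c (\pi_Q v) = \pi_Q (c *: v).
Proof.
apply/eqP; rewrite /quot_scale -Quotient.idealrBE -scalerBr; apply: I_scale.
by rewrite Quotient.idealrBE reprK.
Qed.

Lemma quot_scaleA a b x : quot_scale a (quot_scale b x) = quot_scale (a * b) x.
Proof. by rewrite -[x](@reprK _ Q) !pi_quot_scale scalerA. Qed.

Lemma quot_scale1 x : quot_scale 1 x = x.
Proof. by rewrite -[x](@reprK _ Q) pi_quot_scale scale1r. Qed.

Lemma quot_scaleDr c x y :
  quot_scale c (x + y) = quot_scale c x + quot_scale c y.
Proof.
by rewrite -[x](@reprK _ Q) -[y](@reprK _ Q) -quot_piD !pi_quot_scale -quot_piD scalerDr.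
Qed.

Lemma quot_scaleDl x a b : quot_scale (a + b) x = quot_scale a x + quot_scale b x.
Proof. by rewrite -[x](@reprK _ Q) !pi_quot_scale -quot_piD scalerDl. Qed.

End QuotientModule.

Section LinearFun.
Variables (k : fieldType) (U V : lmodType k) (f : U -> V).
Hypothesis f_lin : linear f.

Lemma linear_fun0 : f 0 = 0.
Proof. by have := f_lin (-1) 0 0; rewrite scaler0 addr0 scaleN1r addNr. Qed.

Lemma linear_funD x y : f (x + y) = f x + f y.
Proof. by rewrite -[x in LHS]scale1r f_lin scale1r. Qed.

Lemma linear_funZ c x : f (c *: x) = c *: f x.
Proof. by rewrite -[c *: x]addr0 f_lin linear_fun0 addr0. Qed.

End LinearFun.

Section Tensor.
Variables (k : fieldType) (V W : lmodType k).
Local Notation F := {freeg (V * W)%type / k}.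

(* The subspace of the free vector space on [V * W] spanned by the bilinearity
   relations. *)
Inductive tensor_relation : F -> Prop :=
| tensor_relation0 : tensor_relation 0
| tensor_relationP c u v :
    tensor_relation u -> tensor_relation v -> tensor_relation (c *: u + v)
| tensor_relationl c x x' y :
    tensor_relation (<< (c *: x + x', y) >> - (c *: << (x, y) >> + << (x', y) >>))
| tensor_relationr c x y y' :
    tensor_relation (<< (x, c *: y + y') >> - (c *: << (x, y) >> + << (x, y') >>)).

Definition tensor_rel : {pred F} := fun u => `[< tensor_relation u >].

Lemma tensor_rel_closed : submod_closed tensor_rel.
Proof.
split=> [|c u v /asboolP hu /asboolP hv]; apply/asboolP.
  exact: tensor_relation0.
exact: tensor_relationP.
Qed.
HB.instance Definition _ := GRing.isZmodClosed.Build F tensor_rel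
  (GRing.submod_closedB tensor_rel_closed).

Lemma tensor_rel_scale c : {in tensor_rel, forall u, c *: u \in tensor_rel}.
Proof.
by move=> u hu; rewrite -[c *: u]addr0 tensor_rel_closed.2 // tensor_rel_closed.1.
Qed.

Definition tensor : Type := Quotient.quot tensor_rel.
HB.instance Definition _ := GRing.Zmodule.on tensor.
HB.instance Definition _ := GRing.Zmodule_isLmodule.Build k tensor
  (quot_scaleA tensor_rel_scale) (quot_scale1 tensor_rel_scale)
  (quot_scaleDr tensor_rel_scale) (quot_scaleDl tensor_rel_scale).

Definition tensor_pi (u : F) : tensor := \pi_(Quotient.quot tensor_rel) u.

Lemma tensor_pi_linear : linear tensor_pi.
Proof.
move=> c u v; rewrite /tensor_pi quot_piD; congr (_ + _).
by rewrite -(pi_quot_scale tensor_rel_scale).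
Qed.
HB.instance Definition _ := GRing.isLinear.Build k F tensor _ tensor_pi
  tensor_pi_linear.

Definition tens (x : V) (y : W) : tensor := tensor_pi << (x, y) >>.

Lemma tensor_pi0 u : tensor_relation u -> tensor_pi u = 0.
Proof.
move=> hu; rewrite -(linear0 tensor_pi).
by apply/eqP; rewrite -Quotient.idealrBE subr0; apply/asboolP.
Qed.

Lemma tens_linearl y : linear (tens^~ y).
Proof.
move=> c x x'; apply/eqP; rewrite -subr_eq0 -linearP -linearB; apply/eqP.
exact/tensor_pi0/tensor_relationl.
Qed.

Lemma tens_linearr x : linear (tens x).
Proof.
move=> c y y'; apply/eqP; rewrite -subr_eq0 -linearP -linearB; apply/eqP.
exact/tensor_pi0/tensor_relationr.
Qed.

End Tensor.

Arguments tensor {k} (V W)%_type_scope.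
Notation "V ⊗ W" := (tensor V W) : type_scope.
Notation "x ⊗ y" := (tens x y) : ring_scope.

Section TensorTheory.
Variables (k : fieldType) (V W : lmodType k).

Lemma tensDl (x x' : V) (y : W) : (x + x') ⊗ y = x ⊗ y + x' ⊗ y.
Proof. exact: (linear_funD (tens_linearl y)). Qed.

Lemma tensDr (x : V) (y y' : W) : x ⊗ (y + y') = x ⊗ y + x ⊗ y'.
Proof. exact: (linear_funD (tens_linearr x)). Qed.

Lemma tens0l (y : W) : (0 : V) ⊗ y = 0.
Proof. exact: (linear_fun0 (tens_linearl y)). Qed.

Lemma tens0r (x : V) : x ⊗ (0 : W) = 0.
Proof. exact: (linear_fun0 (tens_linearr x)). Qed.

Lemma tensZl c (x : V) (y : W) : (c *: x) ⊗ y = c *: (x ⊗ y).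
Proof. exact: (linear_funZ (tens_linearl y)). Qed.

Lemma tensZr c (x : V) (y : W) : x ⊗ (c *: y) = c *: (x ⊗ y).
Proof. exact: (linear_funZ (tens_linearr x)). Qed.

Lemma tens_suml I (r : seq I) (P : pred I) (E : I -> V) (y : W) :
  (\sum_(i <- r | P i) E i) ⊗ y = \sum_(i <- r | P i) E i ⊗ y.
Proof.
elim/big_rec2: _ => [|i z x _ <-]; first exact: tens0l.
exact: tensDl.
Qed.

Lemma tens_sumr I (r : seq I) (P : pred I) (x : V) (E : I -> W) :
  x ⊗ (\sum_(i <- r | P i) E i) = \sum_(i <- r | P i) x ⊗ E i.
Proof.
elim/big_rec2: _ => [|i z y _ <-]; first exact: tens0r.
exact: tensDr.
Qed.

Lemma tensor_ind (P : V ⊗ W -> Prop) :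
  P 0 -> (forall x y, P (x ⊗ y)) -> (forall t u, P t -> P u -> P (t + u)) ->
  forall t, P t.
Proof.
move=> P0 Pt PD t.
have -> : t = tensor_pi (repr t) by rewrite /tensor_pi reprK.
rewrite -[repr t]freeg_sumE linear_sum /=.
elim/big_rec: _ => // -[x y] u _ Pu; apply: PD => //.
have -> : << coeff (x, y) (repr t) *g (x, y) >>
        = coeff (x, y) (repr t) *: << (x, y) >> :> {freeg (V * W)%type / k}.
  by apply/eqP/freeg_eqP => z; rewrite coeffZ !coeffU mul1r.
by rewrite linearZ /= -[tensor_pi _]/(x ⊗ y) -tensZl.
Qed.

Lemma tensor_ext (U : lmodType k) (f g : {linear (V ⊗ W)%type -> U}) :
  (forall x y, f (x ⊗ y) = g (x ⊗ y)) -> f =1 g.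
Proof.
move=> fg; elim/tensor_ind => [|//|t u ft fu]; first by rewrite !linear0.
by rewrite !linearD ft fu.
Qed.

Definition bilinear_map (U : lmodType k) (f : V -> W -> U) : Prop :=
  (forall y, linear (f^~ y)) /\ (forall x, linear (f x)).

(* Meaningful only when [f] is bilinear: it is then the linear map sending
   [x ⊗ y] to [f x y]. *)
Definition tlift (U : lmodType k) (f : V -> W -> U) (t : V ⊗ W) : U :=
  fglift (fun p => f p.1 p.2) (repr t).

Section Lift.
Variables (U : lmodType k) (f : V -> W -> U).
Hypothesis f_bilin : bilinear_map f.
Local Notation ff := (fglift (fun p : V * W => f p.1 p.2)).

Let ffB : {morph ff : u v / u - v}. Proof. exact: lift_is_additive. Qed.
Let ff0 : ff 0 = 0. Proof. by rewrite -(subrr 0) ffB subrr. Qed.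
Let ffD : {morph ff : u v / u + v}.
Proof. by move=> u v; rewrite -{1}[v]opprK -[- v]sub0r !ffB ff0 sub0r opprK. Qed.
Let ffU c z : ff << c *g z >> = c *: f z.1 z.2. Proof. by rewrite liftU. Qed.
Let ffZ c u : ff (c *: u) = c *: ff u.
Proof.
rewrite -[u in LHS]freeg_sumE -[u in RHS]freeg_sumE.
rewrite scaler_sumr !(big_morph ff ffD ff0) scaler_sumr.
apply: eq_bigr => z _.
have -> : c *: << coeff z u *g z >> = << (c * coeff z u) *g z >>
    :> {freeg (V * W)%type / k}.
  by apply/eqP/freeg_eqP => y; rewrite coeffZ !coeffU mulrA.
by rewrite !ffU scalerA.
Qed.

Lemma tlift_pi u : tlift f (tensor_pi u) = ff u.
Proof.
have f0 w : tensor_relation w -> ff w = 0.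
  elim=> [|c v v' _ IH _ IH'|c x x' y|c x y y'] //.
  - by rewrite ffD ffZ IH IH' scaler0 addr0.
  - by rewrite ffB ffD ffZ !ffU !scale1r /= f_bilin.1 subrr.
  - by rewrite ffB ffD ffZ !ffU !scale1r /= f_bilin.2 subrr.
apply/eqP; rewrite -subr_eq0 -ffB; apply/eqP/f0/asboolP.
change (repr (tensor_pi u) - u \in @tensor_rel k V W).
by rewrite Quotient.idealrBE reprK.
Qed.

Lemma tliftE x y : tlift f (x ⊗ y) = f x y.
Proof. by rewrite tlift_pi ffU scale1r. Qed.

Lemma tlift_linear : linear (tlift f).
Proof.
have piE t : t = tensor_pi (repr t) :> V ⊗ W by rewrite /tensor_pi reprK.
move=> c t u; rewrite [t]piE [u]piE -linearP !tlift_pi.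
by rewrite ffD ffZ.
Qed.

End Lift.
End TensorTheory.

Lemma tensor_ext_fun (k : fieldType) (V W U : lmodType k) (f g : V ⊗ W -> U) :
  linear f -> linear g -> (forall x y, f (x ⊗ y) = g (x ⊗ y)) -> f =1 g.
Proof.
move=> lf lg fg.
pose f' : {linear _ -> _} := HB.pack f (GRing.isLinear.Build _ _ _ _ f lf).
pose g' : {linear _ -> _} := HB.pack g (GRing.isLinear.Build _ _ _ _ g lg).
exact: (@tensor_ext _ _ _ _ f' g').
Qed.

Section TensorMap.
Variables (k : fieldType) (V W V' W' : lmodType k).

Definition tmap (f : V -> V') (g : W -> W') : V ⊗ W -> V' ⊗ W' :=
  tlift (fun x y => f x ⊗ g y).

Variables (f : {linear V -> V'}) (g : {linear W -> W'}).

Lemma tmap_bilinear : bilinear_map (fun x y => f x ⊗ g y).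
Proof.
by split=> [y c x x'|x c y y']; rewrite linearP ?tens_linearl ?tens_linearr.
Qed.

Lemma tmapE x y : tmap f g (x ⊗ y) = f x ⊗ g y.
Proof. exact: (tliftE tmap_bilinear). Qed.

HB.instance Definition _ := GRing.isLinear.Build k (V ⊗ W)%type (V' ⊗ W')%type _
  (tmap f g) (tlift_linear tmap_bilinear).

End TensorMap.

Section TensorAssoc.
Variables (k : fieldType) (U V W : lmodType k).

Definition tassoc : (U ⊗ V) ⊗ W -> U ⊗ (V ⊗ W) :=
  tlift (fun t z => tlift (fun x y => x ⊗ (y ⊗ z)) t).

Let bil1 z : bilinear_map (fun (x : U) (y : V) => x ⊗ (y ⊗ (z : W))).
Proof.
by split=> [y c x x'|x c y y']; rewrite ?tens_linearl ?tens_linearr.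
Qed.

Let bil2 :
  bilinear_map (fun t z => tlift (fun (x : U) (y : V) => x ⊗ (y ⊗ (z : W))) t).
Proof.
split=> [z|t c z z']; first exact/tlift_linear/bil1.
elim/tensor_ind: t => [|x y|t u IHt IHu].
- have h w : tlift (fun (x : U) (y : V) => x ⊗ (y ⊗ (w : W))) 0 = 0.
    by rewrite -(tens0l _ 0) tliftE ?tens0l.
  by rewrite !h scaler0 addr0.
- by rewrite !tliftE // !tens_linearr.
- have h w : {morph tlift (fun (x : U) (y : V) => x ⊗ (y ⊗ (w : W)))
                : t u / t + u}.
    by move=> a b; rewrite -[a in LHS]scale1r tlift_linear // scale1r.
  by rewrite !h IHt IHu scalerDr !addrA; congr (_ + _); rewrite addrAC.
Qed.

Lemma tassocE x y z : tassoc ((x ⊗ y) ⊗ z) = x ⊗ (y ⊗ z).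
Proof. by rewrite /tassoc !tliftE. Qed.

HB.instance Definition _ := GRing.isLinear.Build k ((U ⊗ V) ⊗ W)%type
  (U ⊗ (V ⊗ W))%type _ tassoc (tlift_linear bil2).

End TensorAssoc.

(* Linear functionals give [1 ⊗ 1 != 0] in a tensor product of algebras. *)
Section Functional.
Variables (k : fieldType) (V : lmodType k) (v0 : V).
Hypothesis v0_neq0 : v0 <> 0.
Local Open Scope classical_set_scope.

Definition partial_functional (G : set (V * k)) : Prop :=
  (forall c p q, G p -> G q -> G (c *: p.1 + q.1, c * p.2 + q.2)) /\
  (forall c, G (0, c) -> c = 0).

Lemma exists_functional : exists f : V -> k^o, linear f /\ f v0 = 1.
Proof.
pose P G := partial_functional G /\ (G !=set0 -> G (v0, 1)).
have chain (F : set (set (V * k))) : F `<=` P -> total_on F subset ->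
    P (\bigcup_(X in F) X).
  move=> FP Ftot; split; first split.
  - move=> c p q [X FX Xp] [Y FY Yq].
    case: (Ftot X Y FX FY) => [XY|YX].
      by exists Y => //; apply: (FP _ FY).1.1 => //; apply: XY.
    by exists X => //; apply: (FP _ FX).1.1 => //; apply: YX.
  - by move=> c [X FX]; apply: (FP _ FX).1.2.
  - by move=> [p [X FX Xp]]; exists X => //; apply: (FP _ FX).2; exists p.
have [G [[[Glin Gfun] G1] Gmax]] := Zorn_bigcup chain.
have line : P [set p | exists c, p = (c *: v0, c)].
  split; [split|].
  - move=> c _ _ [a ->] [b ->] /=; exists (c * a + b).
    by rewrite scalerDl scalerA.
  - move=> c [a [/esym/eqP]]; rewrite scaler_eq0 => /orP[/eqP -> //|/eqP //].
  - by move=> _; exists 1; rewrite scale1r.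
have Gne : G !=set0.
  apply: contrapT => Gn0; apply: (Gmax _ _ line); split.
    by move=> p Gp; case: Gn0; exists p.
  by move=> sub; apply: Gn0; exists (v0, 1); apply: sub; exists 1; rewrite scale1r.
have {Gne}G1 := G1 Gne.
have G0 : G (0, 0).
  by have := Glin (-1) _ _ G1 G1; rewrite /= scaleN1r mulN1r !addNr.
have Gtot x : exists c, G (x, c).
  apply: contrapT => nGx.
  pose H : set (V * k) := [set p | exists q a, G q /\ p = (q.1 + a *: x, q.2)].
  have PH : P H.
    split; [split|].
    - move=> c _ _ [p [a [Gp ->]]] [q [b [Gq ->]]] /=.
      exists (c *: p.1 + q.1, c * p.2 + q.2), (c * a + b); split=> /=.
        exact: Glin.
      by rewrite scalerDr scalerDl scalerA; congr (_, _); rewrite addrACA.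
    - move=> c [[y d] [a [Gy [/= E ->]]]].
      have [a0|a0] := eqVneq a 0.
        by move: E Gy; rewrite a0 scale0r addr0 => <-; apply: Gfun.
      case: nGx; exists (- a^-1 * d).
      have -> : x = - a^-1 *: y.
        have -> : y = - (a *: x) by apply/eqP; rewrite -addr_eq0 -E.
        by rewrite scalerN scaleNr opprK scalerA mulVf // scale1r.
      by have := Glin (- a^-1) _ _ Gy G0; rewrite /= !addr0.
    - move=> _; exists (v0, 1), 0; split=> //=.
      by rewrite scale0r addr0.
  apply: (Gmax H _ PH); split.
    by move=> [y d] Gy; exists (y, d), 0; rewrite /= scale0r addr0.
  move=> sub; apply: nGx; exists 0; apply: sub.
  by exists (0, 0), 1; rewrite /= scale1r add0r.
pose f x : k^o := projT1 (cid (Gtot x)).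
have fP x : G (x, f x) by rewrite /f; case: cid.
have funG x c d : G (x, c) -> G (x, d) -> c = d.
  move=> Gc Gd; apply/eqP; rewrite -subr_eq0 -opprB oppr_eq0; apply/eqP.
  apply: Gfun; have := Glin (-1) _ _ Gc Gd.
  by rewrite /= scaleN1r addNr mulN1r addrC.
exists f; split=> [c x y|]; last exact: funG (fP _) G1.
exact: funG (fP _) (Glin c _ _ (fP x) (fP y)).
Qed.

End Functional.

Section TensorMap2.
Variables (k : fieldType) (V V' V'' W W' W'' : lmodType k).

(* The bilinear map [(x ⊗ y, x' ⊗ y') |-> f x x' ⊗ g y y']. *)
Definition tmap2 (f : V -> V' -> V'') (g : W -> W' -> W'')
    (t : V ⊗ W) (u : V' ⊗ W') : V'' ⊗ W'' :=
  tlift (fun x y => tmap (f x) (g y) u) t.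

Variables (f : V -> V' -> V'') (g : W -> W' -> W'').
Hypotheses (f_bilin : bilinear_map f) (g_bilin : bilinear_map g).

Let bil1 x y : bilinear_map (fun x' y' => f x x' ⊗ g y y').
Proof.
split=> [y' c x1 x2|x' c y1 y2]; first by rewrite f_bilin.2 tens_linearl.
by rewrite g_bilin.2 tens_linearr.
Qed.

Let lin1 x y : linear (tmap (f x) (g y)).
Proof. exact: tlift_linear. Qed.

Let bil2 u : bilinear_map (fun x y => tmap (f x) (g y) u).
Proof.
split=> [y c x1 x2|x c y1 y2]; elim/tensor_ind: u => [|x' y'|t u IHt IHu].
1,4: by rewrite !(linear_fun0 (lin1 _ _)) scaler0 addr0.
1,3: rewrite /tmap !tliftE //.
- by rewrite f_bilin.1 tens_linearl.
- by rewrite g_bilin.1 tens_linearr.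
- by rewrite !(linear_funD (lin1 _ _)) IHt IHu scalerDr addrACA.
- by rewrite !(linear_funD (lin1 _ _)) IHt IHu scalerDr addrACA.
Qed.

Lemma tmap2E x y x' y' : tmap2 f g (x ⊗ y) (x' ⊗ y') = f x x' ⊗ g y y'.
Proof. by rewrite /tmap2 tliftE ?[tmap _ _ _]tliftE. Qed.

Lemma tmap2_bilinear : bilinear_map (tmap2 f g).
Proof.
split=> [u|t c u u']; first exact: tlift_linear.
have lin2 v : linear (tmap2 f g ^~ v) by exact: tlift_linear.
elim/tensor_ind: t => [|x y|t t' IHt IHt'].
- by rewrite !(linear_fun0 (lin2 _)) scaler0 addr0.
- by rewrite /tmap2 !tliftE // lin1.
- by rewrite !(linear_funD (lin2 _)) IHt IHt' scalerDr addrACA.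
Qed.

End TensorMap2.

Section TensorAlgebra.
Variables (k : fieldType) (A B : algType k).
Local Notation T := (A ⊗ B)%type.

Definition tens_mul : T -> T -> T := tmap2 *%R *%R.

Lemma mul_bilinear (C : algType k) : bilinear_map (@GRing.mul C).
Proof.
by split=> [b c a a'|a c b b'] /=; rewrite ?mulrDl -?scalerAl // mulrDr -scalerAr.
Qed.

Lemma tens_mulE a b a' b' :
  tens_mul (a ⊗ b) (a' ⊗ b') = (a * a') ⊗ (b * b').
Proof. exact: (tmap2E (mul_bilinear A) (mul_bilinear B)). Qed.

Let tens_mul_bilinear : bilinear_map tens_mul.
Proof. exact: (tmap2_bilinear (mul_bilinear A) (mul_bilinear B)). Qed.
Let tens_mul_linearl := tens_mul_bilinear.1.
Let tens_mul_linearr := tens_mul_bilinear.2.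

Let mulDl : left_distributive tens_mul +%R.
Proof. by move=> t t' u; apply: (linear_funD (tens_mul_linearl u)). Qed.
Let mulDr : right_distributive tens_mul +%R.
Proof. by move=> t u u'; apply: (linear_funD (tens_mul_linearr t)). Qed.
Let mul0 t : tens_mul 0 t = 0.
Proof. exact: (linear_fun0 (tens_mul_linearl t)). Qed.
Let mul_0 t : tens_mul t 0 = 0.
Proof. exact: (linear_fun0 (tens_mul_linearr t)). Qed.

Let mulA : associative tens_mul.
Proof.
move=> t u v; elim/tensor_ind: t => [|a b|t t' IH IH'].
- by rewrite !mul0.
- elim/tensor_ind: u => [|a' b'|u u' IH IH'].
  + by rewrite !mul0 !mul_0 mul0.
  + elim/tensor_ind: v => [|a'' b''|v v' IH IH'].
    * by rewrite !mul_0.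
    * by rewrite !tens_mulE !mulrA.
    * by rewrite !mulDr IH IH'.
  + by rewrite mulDl !mulDr mulDl IH IH'.
- by rewrite !mulDl IH IH'.
Qed.

Let mul1 : left_id (1 ⊗ 1) tens_mul.
Proof.
elim/tensor_ind=> [|a b|t u IH IH']; rewrite ?mul_0 //.
  by rewrite tens_mulE !mul1r.
by rewrite mulDr IH IH'.
Qed.

Let mul_1 : right_id (1 ⊗ 1) tens_mul.
Proof.
elim/tensor_ind=> [|a b|t u IH IH']; rewrite ?mul0 //.
  by rewrite tens_mulE !mulr1.
by rewrite mulDl IH IH'.
Qed.

Let tens1_neq0 : (1 : A) ⊗ (1 : B) != 0.
Proof.
have [f [f_lin f1]] : exists f : A -> k^o, linear f /\ f 1 = 1.
  by apply: exists_functional; apply/eqP/oner_neq0.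
have [g [g_lin g1]] : exists g : B -> k^o, linear g /\ g 1 = 1.
  by apply: exists_functional; apply/eqP/oner_neq0.
have bil : bilinear_map (fun a b => f a * g b : k^o).
  split=> [b c a a'|a c b b'].
    by rewrite f_lin mulrDl -scalerAl.
  by rewrite g_lin mulrDr -scalerAr.
apply/eqP => /(congr1 (tlift (fun a b => f a * g b : k^o))).
rewrite -[in RHS](tens0l A (0 : B)) !tliftE // f1 g1 mulr1.
by rewrite (linear_fun0 f_lin) mul0r => /eqP; rewrite oner_eq0.
Qed.

HB.instance Definition _ := GRing.Zmodule_isNzRing.Build T
  mulA mul1 mul_1 mulDl mulDr tens1_neq0.

Lemma tensM (a a' : A) (b b' : B) :
  (a ⊗ b) * (a' ⊗ b') = (a * a') ⊗ (b * b').
Proof. exact: tens_mulE. Qed.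

Let scaleAl c (t u : T) : c *: (t * u) = (c *: t) * u.
Proof. by rewrite [RHS](linear_funZ (tens_mul_linearl u)). Qed.
Let scaleAr c (t u : T) : c *: (t * u) = t * (c *: u).
Proof. by rewrite [RHS](linear_funZ (tens_mul_linearr t)). Qed.

HB.instance Definition _ := GRing.Lmodule_isLalgebra.Build k T scaleAl.
HB.instance Definition _ := GRing.Lalgebra_isAlgebra.Build k T scaleAr.

End TensorAlgebra.

Section TensorComAlgebra.
Variables (k : fieldType) (A B : comAlgType k).
Local Notation T := (A ⊗ B)%type.

Let mulC : commutative (@GRing.mul T).
Proof.
move=> t u; elim/tensor_ind: t => [|a b|t t' IH IH'].
- by rewrite mul0r mulr0.
- elim/tensor_ind: u => [|a' b'|u u' IH IH'].
  + by rewrite mul0r mulr0.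
  + by rewrite !tensM mulrC [b * _]mulrC.
  + by rewrite mulrDl mulrDr IH IH'.
- by rewrite mulrDl mulrDr IH IH'.
Qed.

HB.instance Definition _ := GRing.PzRing_hasCommutativeMul.Build T mulC.

End TensorComAlgebra.

Section TensorMapMorphism.
Variables (k : fieldType) (A B A' B' : algType k).
Variables (f : {lrmorphism A -> A'}) (g : {lrmorphism B -> B'}).

Lemma tmap_monoid_morphism : monoid_morphism (tmap f g).
Proof.
split=> [|t u]; first by rewrite [LHS]tmapE !rmorph1.
elim/tensor_ind: t => [|a b|t t' IH IH'].
- by rewrite mul0r linear0 mul0r.
- elim/tensor_ind: u => [|a' b'|u u' IH IH'].
  + by rewrite mulr0 linear0 mulr0.
  + by rewrite tensM !tmapE tensM !rmorphM.
  + by rewrite mulrDr !linearD /= mulrDr IH IH'.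
- by rewrite mulrDl !linearD /= mulrDl IH IH'.
Qed.

HB.instance Definition _ := GRing.isMonoidMorphism.Build (A ⊗ B)%type
  (A' ⊗ B')%type (tmap f g) tmap_monoid_morphism.

End TensorMapMorphism.

Section TensorAssocMorphism.
Variables (k : fieldType) (A B C : algType k).

Lemma tassoc_monoid_morphism :
  monoid_morphism (@tassoc k A B C).
Proof.
split=> [|t u]; first by rewrite [LHS]tassocE.
elim/tensor_ind: t => [|t c|t t' IH IH'].
- by rewrite mul0r linear0 mul0r.
- elim/tensor_ind: t => [|a b|t t' IH IH'].
  + by rewrite tens0l mul0r linear0 mul0r.
  + elim/tensor_ind: u => [|u c'|u u' IH IH'].
    * by rewrite mulr0 linear0 mulr0.
    * elim/tensor_ind: u => [|a' b'|u u' IH IH'].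
      - by rewrite tens0l mulr0 linear0 mulr0.
      - by rewrite !tensM !tassocE !tensM.
      - by rewrite tensDl mulrDr !linearD /= mulrDr IH IH'.
    * by rewrite mulrDr !linearD /= mulrDr IH IH'.
  + by rewrite tensDl mulrDl !linearD /= mulrDl IH IH'.
- by rewrite mulrDl !linearD /= mulrDl IH IH'.
Qed.

HB.instance Definition _ := GRing.isMonoidMorphism.Build ((A ⊗ B) ⊗ C)%type
  (A ⊗ (B ⊗ C))%type (@tassoc k A B C) tassoc_monoid_morphism.

End TensorAssocMorphism.

(* A bialgebra structure on the algebra [A]. In the counit axioms, [A] is
   identified with [k ⊗ A] and [A ⊗ k] through [a |-> 1 ⊗ a] and
   [a |-> a ⊗ 1]. *)
Record bialgebra (k : fieldType) (A : algType k) := Bialgebra {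
  comul : {lrmorphism A -> (A ⊗ A)%type};
  counit : {lrmorphism A -> k^o};
  comulA : forall a,
    tassoc (tmap comul idfun (comul a)) = tmap idfun comul (comul a);
  counitl : forall a, tmap counit idfun (comul a) = (1 : k^o) ⊗ a;
  counitr : forall a, tmap idfun counit (comul a) = a ⊗ (1 : k^o)
}.

Lemma lrmorphism_eq (k : fieldType) (A : algType k) (B : lalgType k)
    (f g : {lrmorphism A -> B}) : f =1 g -> f = g.
Proof.
case: f g => [f [[fD] [fM] [fZ]]] [g [[gD] [gM] [gZ]]] /= /funext fg.
case: g / fg in gD gM gZ *.
by congr (GRing.LRMorphism.Pack (GRing.LRMorphism.Class _ _ _)); congr (_ _);
  apply: Prop_irrelevance.
Qed.

Lemma bialgebra_eq (k : fieldType) (A : algType k) (S S' : bialgebra A) :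
  comul S =1 comul S' -> counit S =1 counit S' -> S = S'.
Proof.
case: S S' => [d c a l r] [d' c' a' l' r'] /= /lrmorphism_eq dd.
move=> /lrmorphism_eq cc; case: d' / dd in a' l' r' *.
case: c' / cc in a' l' r' *.
by rewrite (Prop_irrelevance a a') (Prop_irrelevance l l') (Prop_irrelevance r r').
Qed.

Definition bialgebra_hom (k : fieldType) (A B : algType k)
    (SA : bialgebra A) (SB : bialgebra B) (f : {lrmorphism A -> B}) : Prop :=
  (forall a, comul SB (f a) = tmap f f (comul SA a)) /\
  (forall a, counit SB (f a) = counit SA a).

Definition right_comodule (k : fieldType) (A : algType k) (S : bialgebra A)
    (V : lmodType k) (rho : {linear V -> (V ⊗ A)%type}) : Prop :=
  (forall v, tassoc (tmap rho idfun (rho v)) = tmap idfun (comul S) (rho v)) /\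
  (forall v, tmap idfun (counit S) (rho v) = v ⊗ (1 : k^o)).

Record leibniz (k : fieldType) (V : lmodType k) := Leibniz {
  bracket :> V -> V -> V;
  bracket_bilinear : bilinear_map bracket;
  leibniz_identity : forall x y z,
    bracket x (bracket y z) = bracket (bracket x y) z - bracket (bracket x z) y
}.

Definition leibniz_hom (k : fieldType) (V W : lmodType k)
    (L : leibniz V) (M : leibniz W) (f : {linear V -> W}) : Prop :=
  forall x y, f (L x y) = M (f x) (f y).

Section TensorLeibniz.
Variables (k : fieldType) (V : lmodType k) (L : leibniz V) (A : comAlgType k).

Definition tensor_bracket : V ⊗ A -> V ⊗ A -> V ⊗ A := tmap2 L *%R.

Lemma tensor_bracketE x y a b :
  tensor_bracket (x ⊗ a) (y ⊗ b) = L x y ⊗ (a * b).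
Proof. exact: (tmap2E (bracket_bilinear L) (mul_bilinear A)). Qed.

Lemma tensor_bracket_bilinear : bilinear_map tensor_bracket.
Proof. exact: (tmap2_bilinear (bracket_bilinear L) (mul_bilinear A)). Qed.

Lemma tensor_leibniz_identity x y z :
  tensor_bracket x (tensor_bracket y z) =
  tensor_bracket (tensor_bracket x y) z - tensor_bracket (tensor_bracket x z) y.
Proof.
have [linl linr] := tensor_bracket_bilinear.
have B0l u := linear_fun0 (linl u); have B0r u := linear_fun0 (linr u).
have BDl u := linear_funD (linl u); have BDr u := linear_funD (linr u).
elim/tensor_ind: x => [|x a|x x' IH IH']; rewrite ?B0l ?subrr //; last first.
  by rewrite !(BDl, BDr) IH IH' opprD addrACA.
elim/tensor_ind: y => [|y b|y y' IH IH']; rewrite ?(B0l, B0r) ?subrr //; last first.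
  by rewrite !(BDl, BDr) IH IH' opprD addrACA.
elim/tensor_ind: z => [|z c|z z' IH IH']; rewrite ?(B0l, B0r) ?subrr //; last first.
  by rewrite !(BDl, BDr) IH IH' opprD addrACA.
rewrite !tensor_bracketE leibniz_identity tensDl -[- (L _ _)]scaleN1r tensZl.
by rewrite scaleN1r !mulrA [a * c * b]mulrAC.
Qed.

Definition tensor_leibniz : leibniz (V ⊗ A)%type :=
  Leibniz tensor_bracket_bilinear tensor_leibniz_identity.

End TensorLeibniz.

(* The algebra k[X_ij | i, j < n]; [X_ij] is the variable of index
   [mxvec_index i j]. *)
Definition matrix_poly (k : fieldType) (n : nat) : comAlgType k :=
  {mpoly k[n * n]}.

Section MatrixPoly.
Variables (k : fieldType) (n : nat).
Local Notation M := (matrix_poly k n).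

Definition mvar (i j : 'I_n) : M := 'X_(mxvec_index i j).

Section Eval.
Variables (A : comAlgType k) (h : 'I_n -> 'I_n -> A).

(* The algebra homomorphism sending [X_ij] to [h i j]. *)
Definition meval_mx : M -> A :=
  mmap (GRing.in_alg A) (mxvec (\matrix_(i, j) h i j) 0).

Lemma meval_mxX i j : meval_mx (mvar i j) = h i j.
Proof. by rewrite /meval_mx mmapX mmap1U mxvecE mxE. Qed.

HB.instance Definition _ := GRing.RMorphism.on meval_mx.

Lemma meval_mx_scalable : scalable meval_mx.
Proof.
by move=> c p; rewrite /meval_mx mmapZ /= -scalerAl mul1r.
Qed.
HB.instance Definition _ := GRing.isScalable.Build k M A _ meval_mx
  meval_mx_scalable.

End Eval.

Lemma matrix_poly_ext (A : algType k) (f g : {lrmorphism M -> A}) :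
  (forall i j, f (mvar i j) = g (mvar i j)) -> f =1 g.
Proof.
move=> fg; elim/mpolyind=> [|c m p _ _ IH]; first by rewrite !linear0.
rewrite !linearP /= IH; congr (_ *: _ + _).
rewrite mpolyXE_id !rmorph_prod; apply: eq_bigr => /= l _.
rewrite !rmorphXn; congr (_ ^+ _).
by case/mxvec_indexP: l => i j; apply: fg.
Qed.

Definition mcomul : M -> (M ⊗ M)%type :=
  meval_mx (fun i j => \sum_s mvar i s ⊗ mvar s j).
HB.instance Definition _ := GRing.LRMorphism.on mcomul.

Definition mcounit : M -> k^o := meval_mx (fun i j => (i == j)%:R : k^o).
HB.instance Definition _ := GRing.LRMorphism.on mcounit.

End MatrixPoly.

Section TensorInclusions.
Variables (k : fieldType) (A B : algType k).

Definition tens_inl (a : A) : (A ⊗ B)%type := a ⊗ 1.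
Definition tens_inr (b : B) : (A ⊗ B)%type := 1 ⊗ b.

HB.instance Definition _ := GRing.isLinear.Build k A (A ⊗ B)%type _ tens_inl
  (tens_linearl 1).
HB.instance Definition _ := GRing.isLinear.Build k B (A ⊗ B)%type _ tens_inr
  (tens_linearr 1).

Lemma tens_inl_monoid_morphism : monoid_morphism tens_inl.
Proof. by split=> [|a a'] //; rewrite tensM mulr1. Qed.
Lemma tens_inr_monoid_morphism : monoid_morphism tens_inr.
Proof. by split=> [|a a'] //; rewrite tensM mulr1. Qed.

HB.instance Definition _ := GRing.isMonoidMorphism.Build A (A ⊗ B)%type
  tens_inl tens_inl_monoid_morphism.
HB.instance Definition _ := GRing.isMonoidMorphism.Build B (A ⊗ B)%type
  tens_inr tens_inr_monoid_morphism.

End TensorInclusions.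

Section MatrixBialgebra.
Variables (k : fieldType) (n : nat).
Local Notation M := (matrix_poly k n).

Lemma mcomulX (i j : 'I_n) :
  mcomul (mvar k i j) = \sum_s mvar k i s ⊗ mvar k s j.
Proof. exact: meval_mxX. Qed.

Lemma mcounitX (i j : 'I_n) : mcounit (mvar k i j) = (i == j)%:R.
Proof. exact: meval_mxX. Qed.

Lemma mcomulA (p : M) :
  tassoc (tmap (@mcomul k n) idfun (mcomul p)) =
  tmap idfun (@mcomul k n) (mcomul p).
Proof.
pose f : {lrmorphism M -> _} :=
  @tassoc k M M M \o tmap (@mcomul k n) idfun \o @mcomul k n.
pose g : {lrmorphism M -> _} := tmap idfun (@mcomul k n) \o @mcomul k n.
apply: (matrix_poly_ext (f := f) (g := g)) => i j /=.
rewrite mcomulX !linear_sum /=.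
under eq_bigr do rewrite tmapE /= mcomulX tens_suml linear_sum /=.
under [RHS]eq_bigr do rewrite tmapE /= mcomulX tens_sumr.
rewrite exchange_big /=; apply: eq_bigr => s _; apply: eq_bigr => t _.
by rewrite tassocE.
Qed.

Lemma mcounitl (p : M) :
  tmap (@mcounit k n) idfun (mcomul p) = (1 : k^o) ⊗ p.
Proof.
pose f : {lrmorphism M -> _} := tmap (@mcounit k n) idfun \o @mcomul k n.
pose g : {lrmorphism M -> _} := @tens_inr k k^o M.
apply: (matrix_poly_ext (f := f) (g := g)) => i j /=.
rewrite mcomulX linear_sum (bigD1 i) //= big1 => [|s ne_si].
  by rewrite addr0 tmapE /= mcounitX eqxx.
by rewrite tmapE /= mcounitX eq_sym (negbTE ne_si) tens0l.
Qed.

Lemma mcounitr (p : M) :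
  tmap idfun (@mcounit k n) (mcomul p) = p ⊗ (1 : k^o).
Proof.
pose f : {lrmorphism M -> _} := tmap idfun (@mcounit k n) \o @mcomul k n.
pose g : {lrmorphism M -> _} := @tens_inl k M k^o.
apply: (matrix_poly_ext (f := f) (g := g)) => i j /=.
rewrite mcomulX linear_sum (bigD1 j) //= big1 => [|s ne_sj].
  by rewrite addr0 tmapE /= mcounitX eqxx.
by rewrite tmapE /= mcounitX (negbTE ne_sj) tens0r.
Qed.

Definition matrix_bialgebra : bialgebra M :=
  @Bialgebra k M (@mcomul k n) (@mcounit k n) mcomulA mcounitl mcounitr.

End MatrixBialgebra.

Section UniversalAlgebra.
Variables (k : fieldType) (h : vectType k) (L : leibniz h).
Variables (n : nat) (e : n.-tuple h).
Local Notation M := (matrix_poly k n).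
Local Notation X := (@mvar k n).

(* Structure constants, when [e] is a basis of [h]:
   [L e_i e_j = \sum_s structure_const i j s *: e_s]. *)
Definition structure_const (i j s : 'I_n) : k := coord e s (L (tnth e i) (tnth e j)).
Local Notation tau := structure_const.

Definition universal_poly (a i j : 'I_n) : M :=
  \sum_u tau i j u *: X a u - \sum_s \sum_t tau s t a *: (X s i * X t j).

Definition universal_ideal : {pred M} := fun p =>
  `[< exists c : 'I_n -> 'I_n -> 'I_n -> M,
        p = \sum_a \sum_i \sum_j c a i j * universal_poly a i j >].

Lemma universal_ideal_closed : idealr_closed universal_ideal.
Proof.
split.
- apply/asboolP; exists (fun _ _ _ => 0).
  by rewrite !big1 // => a _; rewrite big1 // => i _; rewrite big1 // => j _;
    rewrite mul0r.
- apply/negP => /asboolP[c] /(congr1 (meval_mx (fun _ _ => 0 : k^o))).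
  rewrite rmorph1 !rmorph_sum big1 => [/eqP|a _]; first by rewrite oner_eq0.
  rewrite rmorph_sum big1 // => i _; rewrite rmorph_sum big1 // => j _.
  rewrite rmorphM rmorphB /= !rmorph_sum /= !big1 ?subr0 ?mulr0 // => s _.
    by rewrite rmorph_sum big1 //= => t _; rewrite linearZ rmorphM /= !meval_mxX
      mulr0 scaler0.
  by rewrite linearZ /= meval_mxX scaler0.
- move=> q u v /asboolP[c ->] /asboolP[d ->]; apply/asboolP.
  exists (fun a i j => q * c a i j + d a i j).
  rewrite mulr_sumr -big_split; apply: eq_bigr => a _ /=.
  rewrite mulr_sumr -big_split; apply: eq_bigr => i _ /=.
  rewrite mulr_sumr -big_split; apply: eq_bigr => j _ /=.
  by rewrite mulrDl mulrA.
Qed.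

HB.instance Definition _ := isIdealr.Build M universal_ideal
  universal_ideal_closed.

Lemma universal_ideal_scale c :
  {in universal_ideal, forall p, c *: p \in universal_ideal}.
Proof. by move=> p pJ; rewrite -mul_mpolyC; apply: idealMr. Qed.

Definition universal_algebra : Type := {ideal_quot universal_ideal}.
Local Notation A := universal_algebra.

HB.instance Definition _ := GRing.ComNzRing.on A.
HB.instance Definition _ := GRing.Zmodule_isLmodule.Build k A
  (quot_scaleA universal_ideal_scale) (quot_scale1 universal_ideal_scale)
  (quot_scaleDr universal_ideal_scale) (quot_scaleDl universal_ideal_scale).

Definition universal_proj (p : M) : A := \pi_{ideal_quot universal_ideal} p.

Lemma universal_proj_monoid_morphism : monoid_morphism universal_proj.
Proof. by split=> [|p q]; rewrite /universal_proj ?rmorph1 ?rmorphM. Qed.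

Lemma universal_proj_linear : linear universal_proj.
Proof.
move=> c p q; rewrite /universal_proj quot_piD; congr (_ + _).
by rewrite -(pi_quot_scale universal_ideal_scale).
Qed.

HB.instance Definition _ := GRing.isLinear.Build k M A _ universal_proj
  universal_proj_linear.
HB.instance Definition _ := GRing.isMonoidMorphism.Build M A universal_proj
  universal_proj_monoid_morphism.

Lemma universal_proj_surj (x : A) : exists p, x = universal_proj p.
Proof. by exists (repr x); rewrite /universal_proj reprK. Qed.

Lemma universal_scaleAl c (x y : A) : c *: (x * y) = (c *: x) * y.
Proof.
have [p ->] := universal_proj_surj x; have [q ->] := universal_proj_surj y.
by rewrite -linearZ -!rmorphM -linearZ /= -scalerAl.
Qed.

HB.instance Definition _ := GRing.Lmodule_isLalgebra.Build k A universal_scaleAl.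
HB.instance Definition _ := GRing.Lalgebra_isComAlgebra.Build k A.

Lemma universal_proj_eq0 p : (universal_proj p == 0) = (p \in universal_ideal).
Proof. by rewrite -(linear0 universal_proj) -Quotient.idealrBE subr0. Qed.

Definition xvar (i j : 'I_n) : A := universal_proj (X i j).

Definition eta (v : h) : (h ⊗ A)%type :=
  \sum_i coord e i v *: \sum_s tnth e s ⊗ xvar s i.

Lemma eta_linear : linear eta.
Proof.
move=> c v w; rewrite /eta scaler_sumr -big_split; apply: eq_bigr => i _ /=.
by rewrite linearP scalerDl scalerA.
Qed.
HB.instance Definition _ := GRing.isLinear.Build k h (h ⊗ A)%type _ eta eta_linear.

Hypothesis e_basis : basis_of fullv e.

Lemma coord_tnth (i j : 'I_n) : coord e i (tnth e j) = (i == j)%:R.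
Proof. by rewrite (tnth_nth 0) coord_free ?(basis_free e_basis) // eq_sym. Qed.

Lemma eta_basis i : eta (tnth e i) = \sum_s tnth e s ⊗ xvar s i.
Proof.
rewrite /eta (bigD1 i) //= [X in _ + X]big1 => [|j ne_ji].
  by rewrite addr0 coord_tnth eqxx scale1r.
by rewrite coord_tnth (negbTE ne_ji) scale0r.
Qed.

Lemma basis_expand (v : h) : v = \sum_i coord e i v *: tnth e i.
Proof.
rewrite {1}(coord_basis e_basis (memvf v)).
by apply: eq_bigr => i _; rewrite (tnth_nth 0).
Qed.

Lemma universal_relation a i j :
  \sum_u tau i j u *: xvar a u =
  \sum_s \sum_t tau s t a *: (xvar s i * xvar t j).
Proof.
apply/eqP; rewrite -subr_eq0.
have -> : \sum_u tau i j u *: xvar a u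
  - \sum_s \sum_t tau s t a *: (xvar s i * xvar t j)
  = universal_proj (universal_poly a i j).
  rewrite /universal_poly linearB /=; congr (_ - _).
    by rewrite linear_sum; apply: eq_bigr => u _; rewrite linearZ.
  rewrite linear_sum; apply: eq_bigr => s _; rewrite linear_sum /=; apply: eq_bigr => t _.
  by rewrite linearZ rmorphM.
rewrite universal_proj_eq0; apply/asboolP.
exists (fun a' i' j' => ((a' == a) && (i' == i) && (j' == j))%:R).
rewrite (bigD1 a) //= [X in _ + X]big1 ?addr0 => [|a' na]; last first.
  by rewrite big1 // => i' _; rewrite big1 // => j' _; rewrite (negbTE na) mul0r.
rewrite (bigD1 i) //= [X in _ + X]big1 ?addr0 => [|i' ni]; last first.
  by rewrite big1 // => j' _; rewrite (negbTE ni) andbF mul0r.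
rewrite (bigD1 j) //= [X in _ + X]big1 ?addr0 => [|j' nj]; last first.
  by rewrite (negbTE nj) andbF mul0r.
by rewrite !eqxx mul1r.
Qed.

Lemma eta_leibniz_hom : leibniz_hom L (tensor_leibniz L A) eta.
Proof.
have [Ll Lr] := bracket_bilinear L.
have [Tl Tr] := tensor_bracket_bilinear L A.
suff hb i j : eta (L (tnth e i) (tnth e j)) =
    tensor_bracket L (eta (tnth e i)) (eta (tnth e j)).
  have sumf (U W : lmodType k) (f : U -> W) (c : 'I_n -> k) (u : 'I_n -> U) :
      linear f -> f (\sum_i c i *: u i) = \sum_i c i *: f (u i).
    move=> lf; rewrite (big_morph f (linear_funD lf) (linear_fun0 lf)).
    by apply: eq_bigr => i _; rewrite linear_funZ.
  move=> v w /=; rewrite (basis_expand v) (basis_expand w).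
  rewrite (sumf _ _ _ _ _ (Ll _)) /= (sumf _ _ _ _ _ eta_linear).
  rewrite [eta (\sum_i coord e i v *: _)](sumf _ _ _ _ _ eta_linear).
  rewrite (sumf _ _ _ _ _ (Tl _)); apply: eq_bigr => i _; congr (_ *: _).
  rewrite (sumf _ _ _ _ _ (Lr _)) (sumf _ _ _ _ _ eta_linear).
  rewrite [eta (\sum_i coord e i w *: _)](sumf _ _ _ _ _ eta_linear).
  by rewrite (sumf _ _ _ _ _ (Tr _)); apply: eq_bigr => j _; rewrite hb.
rewrite !eta_basis.
have -> : tensor_bracket L (\sum_s tnth e s ⊗ xvar s i)
    (\sum_s tnth e s ⊗ xvar s j) =
  \sum_s \sum_t L (tnth e s) (tnth e t) ⊗ (xvar s i * xvar t j).
  rewrite (big_morph _ (linear_funD (Tl _)) (linear_fun0 (Tl _))).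
  apply: eq_bigr => s _.
  rewrite (big_morph _ (linear_funD (Tr _)) (linear_fun0 (Tr _))).
  by apply: eq_bigr => t _; apply: tensor_bracketE.
transitivity (\sum_a tnth e a ⊗ (\sum_u tau i j u *: xvar a u)).
  rewrite /eta; under eq_bigr do rewrite scaler_sumr.
  rewrite exchange_big; apply: eq_bigr => a _ /=; rewrite tens_sumr.
  by apply: eq_bigr => u _; rewrite tensZr.
under eq_bigr do rewrite universal_relation tens_sumr.
rewrite exchange_big; apply: eq_bigr => s _ /=.
under eq_bigr do rewrite tens_sumr.
rewrite exchange_big; apply: eq_bigr => t _ /=.
rewrite [L _ _ in RHS]basis_expand tens_suml; apply: eq_bigr => a _.
by rewrite tensZr tensZl.
Qed.

End UniversalAlgebra.

(* Main.v *)
From HB Require Import structures.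
Require Import Defs.
From mathcomp Require Import all_boot all_order all_algebra.
From mathcomp Require Import freeg mpoly.
From mathcomp Require boolp.

Set Implicit Arguments.
Unset Strict Implicit.
Unset Printing Implicit Defensive.

Import GRing.Theory.
Local Open Scope ring_scope.

(** An algebra map out of A(h) is a matrix (y_ij) over the target satisfying
    the defining relations of A(h), so Delta and epsilon exist once the matrices
    (\sum_s x_is ⊗ x_sj) and (delta_ij) are shown to satisfy them; the bialgebra
    axioms are then identities between algebra maps, checked on the x_ij.
    Comparing coefficients of e_t in the comodule axioms at e_j shows that these
    axioms are equivalent to the formulas for Delta(x_tj) and epsilon(x_tj),
    hence the uniqueness. *)

Section UniversalAlgebraTheory.
Variables (k : fieldType) (h : vectType k) (L : leibniz h).
Variables (n : nat) (e : n.-tuple h).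
Local Notation M := (matrix_poly k n).
Local Notation A := (universal_algebra L e).
Local Notation x := (xvar L e).
Local Notation tau := (structure_const L e).
Local Notation proj := (universal_proj L e).

(** The [x i j] generate A(h), because [proj] is surjective and [M] is generated by its
    variables. *)
Lemma universal_algebra_ext (B : algType k) (f g : {lrmorphism A -> B}) :
  (forall i j, f (x i j) = g (x i j)) -> f =1 g.
Proof.
move=> fg a; have [p ->] := universal_proj_surj a.
pose f' : {lrmorphism M -> B} := f \o proj.
pose g' : {lrmorphism M -> B} := g \o proj.
exact: (matrix_poly_ext (f := f') (g := g') fg).
Qed.

(** Two representatives of a class differ by an [M]-linear combination of the
    [universal_poly L e a i j], which [f] kills, so evaluating [f] on a chosen representative gives
    a well-defined map. *)
Lemma universal_algebra_factor (B : algType k) (f : {lrmorphism M -> B}) :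
  (forall a i j, f (universal_poly L e a i j) = 0) ->
  exists g : {lrmorphism A -> B}, forall p, g (proj p) = f p.
Proof.
move=> f0; pose g (a : A) : B := f (repr a).
have gE p : g (proj p) = f p.
  apply/eqP; rewrite -subr_eq0 -linearB; apply/eqP.
  have : repr (proj p) - p \in universal_ideal L e.
    by rewrite -universal_proj_eq0 linearB subr_eq0 /= {1}/universal_proj reprK.
  case/boolp.asboolP=> c ->; rewrite linear_sum big1 // => a _.
  rewrite linear_sum big1 // => i _; rewrite linear_sum big1 // => j _.
  by rewrite rmorphM /= f0 mulr0.
(* Both laws pass from [f] to [g] through [gE], since every element of A(h) is some [proj p]. *)
have g_lin : linear g.
  move=> c a b; have [p ->] := universal_proj_surj a.
  by have [q ->] := universal_proj_surj b; rewrite -linearP !gE linearP.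
have g_mul : monoid_morphism g.
  split=> [|a b]; first by rewrite -(rmorph1 proj) gE rmorph1.
  have [p ->] := universal_proj_surj a; have [q ->] := universal_proj_surj b.
  by rewrite -rmorphM !gE rmorphM.
pose G : {lrmorphism A -> B} := HB.pack g
  (GRing.isLinear.Build _ _ _ _ g g_lin)
  (GRing.isMonoidMorphism.Build _ _ g g_mul).
by exists G.
Qed.

(** Evaluation at [y] sends [universal_poly L e a i j] to the difference of the two sides of the
    hypothesis. *)
Lemma universal_algebra_lift (B : comAlgType k) (y : 'I_n -> 'I_n -> B) :
  (forall a i j, \sum_u tau i j u *: y a u =
     \sum_s \sum_t tau s t a *: (y s i * y t j)) ->
  exists g : {lrmorphism A -> B}, forall p, g (proj p) = meval_mx y p.
Proof.
move=> y_rel; have [f fE] : exists f : {lrmorphism M -> B}, f =1 meval_mx y.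
  by exists (meval_mx y).
have fX i j : f (mvar k i j) = y i j by rewrite fE meval_mxX.
have [|g gE] := universal_algebra_factor (f := f); last first.
  by exists g => p; rewrite gE fE.
move=> a i j; rewrite /universal_poly linearB /=; apply/eqP.
rewrite subr_eq0; apply/eqP; rewrite !linear_sum /=.
under eq_bigr do rewrite linearZ /= fX.
rewrite y_rel; apply: eq_bigr => s _; rewrite linear_sum /=.
by apply: eq_bigr => t _; rewrite linearZ /= rmorphM /= !fX.
Qed.

(* Both sides equal the sum over [p, q] of
   [(\sum_c tau p q c *: x a c) ⊗ (x p i * x q j)], by one use of the relations
   of A(h) in each tensor factor. *)
Lemma comul_relation a i j :
  \sum_u tau i j u *: (\sum_s x a s ⊗ x s u) =
  \sum_s \sum_t tau s t a *:
    ((\sum_p x s p ⊗ x p i) * (\sum_q x t q ⊗ x q j)) :> (A ⊗ A)%type.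
Proof.
transitivity (\sum_p \sum_q
    (\sum_c tau p q c *: x a c) ⊗ (x p i * x q j) : (A ⊗ A)%type).
  transitivity (\sum_c x a c ⊗ (\sum_u tau i j u *: x c u) : (A ⊗ A)%type).
    under eq_bigr do rewrite scaler_sumr.
    rewrite exchange_big; apply: eq_bigr => c _ /=; rewrite tens_sumr.
    by apply: eq_bigr => u _; rewrite tensZr.
  under eq_bigr do rewrite universal_relation tens_sumr.
  rewrite exchange_big; apply: eq_bigr => p _ /=.
  under eq_bigr do rewrite tens_sumr.
  rewrite exchange_big; apply: eq_bigr => q _ /=; rewrite tens_suml.
  by apply: eq_bigr => c _; rewrite tensZr tensZl.
symmetry.
transitivity (\sum_s \sum_t \sum_p \sum_q
    tau s t a *: ((x s p * x t q) ⊗ (x p i * x q j)) : (A ⊗ A)%type).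
  apply: eq_bigr => s _; apply: eq_bigr => t _.
  rewrite mulr_suml scaler_sumr; apply: eq_bigr => p _.
  rewrite mulr_sumr scaler_sumr; apply: eq_bigr => q _.
  by rewrite tensM.
under eq_bigr do rewrite exchange_big.
rewrite exchange_big; apply: eq_bigr => p _ /=.
under eq_bigr do rewrite exchange_big.
rewrite exchange_big; apply: eq_bigr => q _ /=.
rewrite universal_relation tens_suml; apply: eq_bigr => s _.
by rewrite tens_suml; apply: eq_bigr => t _; rewrite tensZl.
Qed.

(** The Kronecker deltas collapse both sides to [tau i j a]. *)
Lemma counit_relation a i j :
  \sum_u tau i j u *: ((a == u)%:R : k^o) =
  \sum_s \sum_t tau s t a *: (((s == i)%:R : k^o) * (t == j)%:R).
Proof.
rewrite (bigD1 a) //= big1 => [|u ne_ua]; last first.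
  by rewrite eq_sym (negbTE ne_ua) scaler0.
rewrite (bigD1 i) //= [X in _ = _ + X]big1 => [|s ne_si]; last first.
  by rewrite big1 // => t _; rewrite (negbTE ne_si) mul0r scaler0.
rewrite (bigD1 j) //= [X in _ = _ + X + _]big1 => [|t ne_tj]; last first.
  by rewrite (negbTE ne_tj) mulr0 scaler0.
by rewrite !eqxx mulr1 !addr0.
Qed.

Lemma universal_bialgebra :
  exists S : bialgebra A,
    (forall i j, comul S (x i j) = \sum_s x i s ⊗ x s j) /\
    (forall i j, counit S (x i j) = (i == j)%:R).
Proof.
have [D DE] := universal_algebra_lift comul_relation.
have [E EE] := universal_algebra_lift counit_relation.
have Dx i j : D (x i j) = \sum_s x i s ⊗ x s j by rewrite DE meval_mxX.
have Ex i j : E (x i j) = (i == j)%:R by rewrite EE meval_mxX.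
have DA a : tassoc (tmap D idfun (D a)) = tmap idfun D (D a).
  pose f : {lrmorphism A -> _} := @tassoc k A A A \o tmap D idfun \o D.
  pose g : {lrmorphism A -> _} := tmap idfun D \o D.
  apply: (universal_algebra_ext (f := f) (g := g)) => i j /=.
  rewrite Dx !linear_sum /=.
  under eq_bigr do rewrite tmapE /= Dx tens_suml linear_sum /=.
  under [RHS]eq_bigr do rewrite tmapE /= Dx tens_sumr.
  (* The inner index on the left plays the role of the outer one on the right; after the exchange
     both sides sum [x i s ⊗ (x s t ⊗ x t j)]. *)
  rewrite exchange_big /=; apply: eq_bigr => s _; apply: eq_bigr => t _.
  by rewrite tassocE.
have El a : tmap E idfun (D a) = (1 : k^o) ⊗ a.
  pose f : {lrmorphism A -> _} := tmap E idfun \o D.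
  (* Since [a |-> 1 ⊗ a] is itself an algebra map, it can be compared with [f] on generators
     alone. *)
  pose g : {lrmorphism A -> _} := @tens_inr k k^o A.
  apply: (universal_algebra_ext (f := f) (g := g)) => i j /=.
  rewrite Dx linear_sum (bigD1 i) //= big1 => [|s ne_si].
    by rewrite addr0 tmapE /= Ex eqxx.
  by rewrite tmapE /= Ex eq_sym (negbTE ne_si) tens0l.
have Er a : tmap idfun E (D a) = a ⊗ (1 : k^o).
  pose f : {lrmorphism A -> _} := tmap idfun E \o D.
  pose g : {lrmorphism A -> _} := @tens_inl k A k^o.
  apply: (universal_algebra_ext (f := f) (g := g)) => i j /=.
  rewrite Dx linear_sum (bigD1 j) //= big1 => [|s ne_sj].
    by rewrite addr0 tmapE /= Ex eqxx.
  by rewrite tmapE /= Ex (negbTE ne_sj) tens0r.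
by exists (Bialgebra DA El Er).
Qed.

(** Each compatibility is an equality of algebra maps out of [M], so it is decided on the variables,
    where the formulas for [M] and A(h) have the same shape. *)
Lemma universal_proj_bialgebra_hom (S : bialgebra A) :
  (forall i j, comul S (x i j) = \sum_s x i s ⊗ x s j) ->
  (forall i j, counit S (x i j) = (i == j)%:R) ->
  bialgebra_hom (matrix_bialgebra k n) S proj.
Proof.
move=> SD SE; split=> p.
  pose f : {lrmorphism M -> _} := comul S \o proj.
  pose g : {lrmorphism M -> _} := tmap proj proj \o @mcomul k n.
  apply: (matrix_poly_ext (f := f) (g := g)) => i j /=.
  rewrite mcomulX SD linear_sum /=.
  by apply: eq_bigr => s _; rewrite tmapE.
pose f : {lrmorphism M -> _} := counit S \o proj.
apply: (matrix_poly_ext (f := f) (g := @mcounit k n)) => i j /=.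
by rewrite mcounitX SE.
Qed.

Hypothesis e_basis : basis_of fullv e.

Lemma linear_basis_ext (U : lmodType k) (f g : {linear h -> U}) :
  (forall i, f (tnth e i) = g (tnth e i)) -> f =1 g.
Proof.
move=> fg v; rewrite (basis_expand e_basis v) !linear_sum.
by apply: eq_bigr => i _; rewrite !linearZ /= fg.
Qed.

(** Applying the functional [coord e t] to the first tensor factor extracts the coefficient
    [u t]. *)
Lemma tens_basis_inj (U : lmodType k) (u w : 'I_n -> U) :
  \sum_i tnth e i ⊗ u i = \sum_i tnth e i ⊗ w i -> u =1 w.
Proof.
have bil t : bilinear_map (fun (v : h) (z : U) => coord e t v *: z).
  split=> [z c v v'|v c z z']; first by rewrite linearP scalerDl scalerA.
  by rewrite scalerDr !scalerA mulrC.
move=> uw t; have lin := tlift_linear (bil t).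
have coefE (z : 'I_n -> U) :
    tlift (fun v z => coord e t v *: z) (\sum_i tnth e i ⊗ z i) = z t.
  rewrite (big_morph _ (linear_funD lin) (linear_fun0 lin)).
  rewrite (bigD1 t) //= tliftE // coord_tnth // eqxx scale1r.
  rewrite big1 ?addr0 // => i ne_it.
  by rewrite tliftE // coord_tnth // eq_sym (negbTE ne_it) scale0r.
by rewrite -coefE uw coefE.
Qed.

(** Evaluated at [tnth e i], both sides of each axiom become sums of terms [tnth e t ⊗ _]. Left to
    right, coefficients are compared, which gives uniqueness; right to left, linearity extends the
    equality from the basis to [h], which gives existence. *)
Lemma eta_right_comoduleP (S : bialgebra A) :
  right_comodule S (eta L e) <->
  (forall i j, comul S (x i j) = \sum_s x i s ⊗ x s j) /\
  (forall i j, counit S (x i j) = (i == j)%:R).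
Proof.
have lhsE i : tassoc (tmap (eta L e) idfun (eta L e (tnth e i))) =
    \sum_t tnth e t ⊗ (\sum_s x t s ⊗ x s i : (A ⊗ A)%type).
  rewrite eta_basis // !linear_sum /=.
  under eq_bigr do rewrite tmapE /= eta_basis // tens_suml linear_sum /=.
  rewrite exchange_big; apply: eq_bigr => t _ /=; rewrite tens_sumr.
  by apply: eq_bigr => s _; rewrite tassocE.
have rhsE i : tmap idfun (comul S) (eta L e (tnth e i)) =
    \sum_t tnth e t ⊗ comul S (x t i).
  by rewrite eta_basis // linear_sum; apply: eq_bigr => t _; rewrite /= tmapE.
have unitE i : tmap idfun (counit S) (eta L e (tnth e i)) =
    \sum_t tnth e t ⊗ counit S (x t i).
  by rewrite eta_basis // linear_sum; apply: eq_bigr => t _; rewrite /= tmapE.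
have idE i : tnth e i ⊗ (1 : k^o) = \sum_t tnth e t ⊗ ((t == i)%:R : k^o).
  rewrite (bigD1 i) //= eqxx big1 ?addr0 // => t ne_ti.
  by rewrite (negbTE ne_ti) tens0r.
split=> [[coact counital]|[SD SE]].
  split=> i j.
    (* The column [j] is fixed and the coefficients are indexed by the row; the one at row [i] is
       the formula sought. *)
    apply/esym/(tens_basis_inj (u := fun t => \sum_s x t s ⊗ x s j)
      (w := fun t => comul S (x t j))).
    by rewrite -lhsE coact rhsE.
  apply: (tens_basis_inj (u := fun t => counit S (x t j))
    (w := fun t => (t == j)%:R)).
  by rewrite -unitE counital idE.
split=> v.
  pose f : {linear h -> _} :=
    @tassoc k h A A \o tmap (eta L e) idfun \o eta L e.
  pose g : {linear h -> _} := tmap idfun (comul S) \o eta L e.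
  apply: (linear_basis_ext (f := f) (g := g)) => i /=.
  by rewrite lhsE rhsE; apply: eq_bigr => t _; rewrite SD.
pose f : {linear h -> _} := tmap idfun (counit S) \o eta L e.
(* Linearity of [v |-> v ⊗ 1] allows the counit axiom to be tested on the basis. *)
pose g : {linear h -> _} := HB.pack (fun v : h => v ⊗ (1 : k^o))
  (GRing.isLinear.Build _ _ _ _ _ (tens_linearl (V := h) (1 : k^o))).
apply: (linear_basis_ext (f := f) (g := g)) => i /=.
by rewrite unitE idE; apply: eq_bigr => t _; rewrite SE.
Qed.

End UniversalAlgebraTheory.

Theorem proposition2p10 (k : fieldType) (h : vectType k) (L : leibniz h)
    (n : nat) (e : n.-tuple h) (e_basis : basis_of fullv e) :
  exists S : bialgebra (universal_algebra L e),
    unique (fun S' : bialgebra (universal_algebra L e) =>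
              right_comodule S' (eta L e)) S /\
    (forall i j : 'I_n,
        comul S (xvar L e i j) = \sum_s (xvar L e i s ⊗ xvar L e s j)) /\
    (forall i j : 'I_n, counit S (xvar L e i j) = (i == j)%:R) /\
    bialgebra_hom (matrix_bialgebra k n) S (universal_proj L e).
Proof.
have [S [SD SE]] := universal_bialgebra L e; exists S.
split; last by split=> //; split=> //; apply: universal_proj_bialgebra_hom.
split=> [|S' /(eta_right_comoduleP e_basis)[SD' SE']].
  by apply/(eta_right_comoduleP e_basis).
(* The two structure maps determine a bialgebra structure, and as algebra maps they are determined
   by their values on the [x i j]. *)
apply: bialgebra_eq; apply: universal_algebra_ext => i j.
  by rewrite SD SD'.
by rewrite SE SE'.
Qed.
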